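(* Let $\omega\in\mathbb{R}\setminus\mathbb{Q}$. For any $\mu>1$ and any $m\in\mathbb{N}$, $m\ge1$, $$\dim_H\bigcap_{l=0}^{m-1}\mathcal{A}_{\mu,\omega}(l,m)=\frac1\mu,$$ where for $0\le l<m$ $$\mathcal{A}_{\mu,\omega}(l,m)=\{t\in\mathbb{R}/\mathbb{Z}:\ \|t+p\omega\|<|p|^{-\mu}\text{ for infinitely many positive and infinitely many negative integers } p\equiv l \bmod m\}.$$
   Context: $\|\cdot\|$ denotes the standard distance to $0$ on the circle $\mathbb{S}^1=\mathbb{R}/\mathbb{Z}$ of unit length (distance to the nearest integer). $\dim_H$ denotes Hausdorff dimension. *)

(* Defs.v *)
From HB Require Import structures.
From mathcomp Require Import all_boot all_order all_algebra.
From mathcomp Require Import generic_quotient ring_quotient.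
From mathcomp Require Import all_classical all_reals all_analysis.
From mathcomp Require Import lra.

Set Implicit Arguments.
Unset Strict Implicit.
Unset Printing Implicit Defensive.

Import Order.TTheory GRing.Theory Num.Theory.
Import numFieldNormedType.Exports.

Local Open Scope classical_set_scope.
Local Open Scope ring_scope.
Local Open Scope quotient_scope.

Section DistToInt.
Variable R : realType.
Implicit Types x y : R.

Definition dist_to_int x : R := inf [set `|x - k%:~R| | k in [set: int]].

Lemma dist_to_int_le x (k : int) : dist_to_int x <= `|x - k%:~R|.
Proof.
apply: ge_inf; last by exists k.
by exists 0 => _ [j _ <-]; exact: normr_ge0.
Qed.

Lemma dist_to_int_attained x : exists k : int, dist_to_int x = `|x - k%:~R|.
Proof.
pose f := Num.floor x; pose a := x - f%:~R.
have a0 : 0 <= a by rewrite subr_ge0; exact: floor_le.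
have a1 : a < 1.
  by rewrite ltrBlDl; have := floor_itv x; rewrite intrD => /andP[].
have lo (z : R) : (forall k : int, z <= `|x - k%:~R|) -> z <= dist_to_int x.
  by move=> h; apply: lb_le_inf => [|_ [k _ <-]//]; exists `|x - 0%:~R|, 0.
have key (k : int) : (Num.min a (1 - a) <= `|x - k%:~R|).
  rewrite ge_min; have [kf|fk] := leP k f.
    apply/orP; left; apply: le_trans (ler_norm _).
    by rewrite lerD2l lerN2 ler_int.
  apply/orP; right; rewrite distrC; apply: le_trans (ler_norm _).
  have : (f + 1)%:~R <= k%:~R :> R by rewrite ler_int lezD1.
  by rewrite intrD /a; lra.
have := lo _ key.
rewrite /Num.min; case: ifP => _ h.
  exists f; apply/eqP; rewrite eq_le dist_to_int_le/=.
  by rewrite (ger0_norm a0).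
exists (f + 1); apply/eqP; rewrite eq_le dist_to_int_le/= intrD.
by rewrite distrC ger0_norm; [move: h; rewrite /a; lra|move: a1; rewrite /a; lra].
Qed.

Lemma dist_to_int_ge0 x : 0 <= dist_to_int x.
Proof. by have [k ->] := dist_to_int_attained x; exact: normr_ge0. Qed.

Lemma dist_to_int_eq0 x : (dist_to_int x == 0) = (x \is a Num.int).
Proof.
apply/idP/idP => [|/intrP[k ->]].
  have [k ->] := dist_to_int_attained x.
  by rewrite normr_eq0 subr_eq0 => /eqP ->; exact: intr_int.
by rewrite eq_le dist_to_int_ge0 andbT (le_trans (dist_to_int_le _ k))// subrr normr0.
Qed.

Lemma dist_to_intN x : dist_to_int (- x) = dist_to_int x.
Proof.
have h y : dist_to_int (- y) <= dist_to_int y.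
  have [k ->] := dist_to_int_attained y.
  by rewrite (le_trans (dist_to_int_le _ (- k)))// intrN opprK addrC distrC.
by apply/eqP; rewrite eq_le h -{1}[x]opprK h.
Qed.

Lemma dist_to_intD x y : dist_to_int (x + y) <= dist_to_int x + dist_to_int y.
Proof.
have [j ->] := dist_to_int_attained x; have [k ->] := dist_to_int_attained y.
apply: le_trans (dist_to_int_le _ (j + k)) _.
by rewrite intrD opprD addrACA; exact: ler_normD.
Qed.

End DistToInt.

(* R/Z as a quotient of additive groups *)
Definition circle (R : realType) : Type :=
  Quotient.quot (GRing.ZmodClosed.clone R (@Num.int_num_subdef R) _).

HB.instance Definition _ (R : realType) := GRing.Zmodule.on (circle R).
HB.instance Definition _ (R : realType) := Quotient.on (circle R).

Section Circle.
Variable R : realType.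
Implicit Types s t u : circle R.

Lemma circle_piD (x y : R) :
  \pi_(circle R) (x + y) = \pi_(circle R) x + \pi_(circle R) y.
Proof. exact: Quotient.pi_add. Qed.

Lemma circle_piN (x : R) : \pi_(circle R) (- x) = - \pi_(circle R) x.
Proof. exact: Quotient.pi_opp. Qed.

(* independent of the chosen representative, see [circle_norm_pi] *)
Definition circle_norm t : R := dist_to_int (repr t).

Lemma circle_norm_pi (x : R) : circle_norm (\pi_(circle R) x) = dist_to_int x.
Proof.
rewrite /circle_norm.
have : repr (\pi_(circle R) x) = x %[mod circle R] by rewrite reprK.
move/eqP; rewrite -Quotient.idealrBE => /intrP[k /(canRL (subrK x)) ->].
have h (y : R) (j : int) : dist_to_int (j%:~R + y) <= dist_to_int y.
  rewrite (le_trans (dist_to_intD _ _))// gerDr.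
  by have := dist_to_int_eq0 (j%:~R : R); rewrite intr_int => /eqP ->.
apply/eqP; rewrite eq_le h/=.
by rewrite -{1}[x](addKr k%:~R) -intrN h.
Qed.

Lemma circle_norm_eq0 t : circle_norm t = 0 -> t = 0.
Proof.
rewrite -[t]reprK circle_norm_pi => /eqP; rewrite dist_to_int_eq0 => tZ.
by apply/eqP; rewrite piE Quotient.equivE subr0.
Qed.

Lemma circle_normN t : circle_norm (- t) = circle_norm t.
Proof.
by rewrite -[t]reprK -circle_piN !circle_norm_pi dist_to_intN.
Qed.

Lemma circle_normD s t : circle_norm (s + t) <= circle_norm s + circle_norm t.
Proof.
by rewrite -[s]reprK -[t]reprK -circle_piD !circle_norm_pi dist_to_intD.
Qed.

Definition circle_dist s t : R := circle_norm (t - s).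

Lemma circle_distxx t : circle_dist t t = 0.
Proof.
rewrite /circle_dist subrr (_ : 0 = \pi_(circle R) 0); last first.
  by rewrite -[RHS]addr0 -{2}(subrr (\pi_(circle R) 0)) addrA -circle_piD addr0 subrr.
by rewrite circle_norm_pi; apply/eqP; rewrite dist_to_int_eq0 int_num0.
Qed.

Lemma circle_dist_eq0 s t : circle_dist s t = 0 -> s = t.
Proof. by move/circle_norm_eq0/eqP; rewrite subr_eq0 => /eqP. Qed.

Lemma circle_distC s t : circle_dist s t = circle_dist t s.
Proof. by rewrite /circle_dist -circle_normN opprB. Qed.

Lemma circle_dist_triangle t s u :
  circle_dist s u <= circle_dist s t + circle_dist t u.
Proof.
rewrite /circle_dist -(subrKA t u (- s)) [leRHS]addrC.
exact: circle_normD.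
Qed.

End Circle.

HB.instance Definition _ (R : realType) :=
  isMetric.Build R (circle R) (@circle_distxx R) (@circle_dist_eq0 R)
    (@circle_distC R) (@circle_dist_triangle R).

Section HausdorffDimension.
Context {R : realType} {M : metricType R}.
Implicit Types (A U : set M) (s delta : R).
Local Open Scope ereal_scope.

(* [-oo] on the empty set *)
Definition diam A : \bar R :=
  ereal_sup [set (mdist z.1 z.2)%:E | z in A `*` A].

(* The empty set is treated apart because it must count for 0 even when
   [s = 0], whereas [poweR x 0 = 1] for every [x]. *)
Definition diam_pow s U : \bar R := if U == set0 then 0 else diam U `^ s.

Definition hausdorff_premeasure s delta A : \bar R :=
  ereal_inf [set \sum_(0 <= k <oo) diam_pow s (U k) | U in
    [set U : nat -> set M |
      (forall k, diam (U k) <= delta%:E) /\ A `<=` \bigcup_k U k]].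

Definition hausdorff_measure s A : \bar R :=
  ereal_sup [set hausdorff_premeasure s delta A |
    delta in [set delta | (0 < delta)%R]].

Definition hausdorff_dim A : \bar R :=
  ereal_inf [set s%:E | s in [set s | (0 <= s)%R /\ hausdorff_measure s A = 0]].

End HausdorffDimension.

Section ApproximationSets.
Variable R : realType.
Implicit Types mu omega : R.

Definition close_time mu omega (t : circle R) (p : int) : Prop :=
  circle_norm (t + \pi_(circle R) (p%:~R * omega)) < `|p%:~R| `^ (- mu).

Definition approx_set mu omega (l m : nat) : set (circle R) :=
  [set t |
    infinite_set [set p : int |
      [/\ 0 < p, (p = l %[mod m])%Z & close_time mu omega t p]] /\
    infinite_set [set p : int |
      [/\ p < 0, (p = l %[mod m])%Z & close_time mu omega t p]]].

End ApproximationSets.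

(* Main.v *)
Require Import Defs.
From mathcomp Require Import all_boot all_order all_algebra.
From mathcomp Require Import all_classical all_reals all_analysis.
From mathcomp Require Import generic_quotient finmap ring lra zify.

Set Implicit Arguments.
Unset Strict Implicit.
Unset Printing Implicit Defensive.

Import Order.TTheory GRing.Theory Num.Theory.
Import numFieldNormedType.Exports.

Local Open Scope classical_set_scope.
Local Open Scope ring_scope.
Local Open Scope quotient_scope.

(** Upper bound.  A point of the set lies, for arbitrarily large [p], in the arc of
radius [p `^ (- mu)] around [- p omega], and [\sum (2 p `^ (- mu)) `^ s]
converges as soon as [mu * s > 1].  The tails of this family of arcs are covers
of arbitrarily small mass ([hausdorff_measure_limsup0]).

Lower bound.  Let [mu * s < 1].  For every class, sign and threshold, the points
[- p omega] with [p] in that class are, along a suitable sequence of scales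
[q^-1], dense at scale [q^-1] with [|p|] of order [q]: this follows from a good
rational approximation of [m omega] ([coprime_approximation],
[equidistributed_multiples]).  So at each such scale every interval of length
comparable to [q^-1] contains an interval of length comparable to [q `^ (- mu)]
whose points are all well approximated ([ubiquitous_hit_beyond]).  The scales may
be as sparse as one likes, so the conditions for all classes and both
signs can be imposed in turn along one sequence of nested intervals, and the
resulting Cantor set loses no dimension.

Instead of putting a measure on that Cantor set, one fixes a countable cover with
small [\sum (diam U_k) `^ s] and chooses the nested intervals so as to escape it:
among the many children of an interval, an averaging argument finds one that
touches a proportionally small part of the cover ([light_child]).  The limit
point belongs to the set and to no member of the cover ([ubiquitous_avoid]), so
the [s]-dimensional measure is not zero
([hausdorff_measure_approx_set_neq0]). *)

(** * Avoiding a cover inside an intersection of ubiquitous sets *)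

Section Avoidance.
Variable R : realType.
Implicit Types (s a b g l L : R) (G : set R) (V : nat -> set R) (r : nat -> R).

(** A one-scale form of large intersection: at some arbitrarily small scale [g],
every interval of length [g] contains an interval of length [l] inside [G],
and [l `^ s] exceeds [g] by an arbitrarily large factor.  For balls of radius
[q `^ (- mu)] around points that are [q^-1]-dense, this is the condition
[mu * s < 1]. *)
Definition ubiquitous s G :=
  forall M, 0 < M -> exists g l, [/\ 0 < l <= g, M * g <= l `^ s, M * g <= 1 &
    forall a, exists2 y, a <= y <= a + g & forall x, y <= x <= y + l -> G x].

Definition meets V a L k := exists2 x, a <= x <= a + L & V k x.

(** The invariant of the construction: with respect to the [s]-dimensional mass
[r k `^ s] of its members, the part of the cover that touches the interval is
small compared with the interval.  Partial sums take the place of the series,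
so that no convergence has to be discussed.  Any constant up to [12^-1] leaves
enough room in [light_child]. *)
Definition light V r s a L := forall K,
  \sum_(k < K | `[< meets V a L k >]) r k `^ s <= 12^-1 * L `^ s.

Lemma card_ord_spread N (A : {set 'I_N}) (D : R) : 0 <= D ->
  (forall i j, i \in A -> j \in A -> (i <= j)%N -> (j - i)%N%:R <= D) ->
  #|A|%:R <= 1 + D.
Proof.
move=> D0 AD; have [->|[x xA]] := set_0Vmem A; first by rewrite cards0 addr_ge0.
case: (arg_minnP val xA) => i iA imin; case: (arg_maxnP val xA) => j jA jmax.
have ij : (i <= j)%N by exact: imin.
apply: (@le_trans _ _ (1 + (j - i)%N%:R)); last by rewrite lerD2l AD.
rewrite -[1]/(1%:R) -natrD ler_nat cardE -(size_map val).
rewrite -(size_iota i (1 + (j - i)))%N.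
apply: uniq_leq_size; first by rewrite map_inj_uniq ?enum_uniq//; exact: val_inj.
move=> z /mapP[k]; rewrite mem_enum => kA ->; rewrite mem_iota imin//=.
by rewrite add1n addnS subnKC// ltnS; exact: jmax.
Qed.

(** Truncation lets one count, in a single sum, the cover sets that are too big
to be allowed near a child interval and the small ones that are merely
harmful in number. *)
Lemma min_sum_le (I : Type) (t : seq I) (P : pred I) (u : I -> R) (c : R) :
  0 <= c -> (forall i, 0 <= u i) ->
  Num.min (\sum_(i <- t | P i) u i) c <= \sum_(i <- t | P i) Num.min (u i) c.
Proof.
move=> c0 u0.
suff [] : 0 <= \sum_(i <- t | P i) u i /\
  Num.min (\sum_(i <- t | P i) u i) c <= \sum_(i <- t | P i) Num.min (u i) c by [].
elim/big_rec2 : _ => [|i y x _ [x0 xy]]; first by rewrite ge_min lexx.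
split; first exact: addr_ge0.
apply: (@le_trans _ _ (Num.min (u i) c + Num.min x c)); last by rewrite lerD2l.
have := u0 i; rewrite /Num.min.
by case: ifPn => h1; case: ifPn => h2; case: ifPn => h3; move: h1 h2 h3;
  rewrite -?leNgt; lra.
Qed.

(** A cover set that touches a light interval has by itself less mass than the
interval, hence is shorter. *)
Lemma light_meets V r s a L k : 0 < s -> 0 < L -> (forall k, 0 < r k) ->
  light V r s a L -> meets V a L k -> r k <= L.
Proof.
move=> s0 L0 r0 lightL kV; rewrite leNgt; apply/negP => Lr.
have : L `^ s < r k `^ s by apply: gt0_ltr_powR; rewrite // nnegrE ltW.
apply/negP; rewrite -leNgt; apply: (@le_trans _ _ (12^-1 * L `^ s)).
  apply: le_trans (lightL k.+1); rewrite (bigD1 ord_max)/=; last exact/asboolP.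
  by rewrite lerDl sumr_ge0// => i _; exact: powR_ge0.
by rewrite ger_pMl ?powR_gt0//; lra.
Qed.

(** Averaging argument.  Cut the interval into about [L / (3 g)] cells of length
[3 g]; each contains a child of length [l] lying in [G], and the children are
at distance at least [g] from each other, so a set of diameter [r] touches at
most [1 + r / g] of them.  If no child were light, each would see truncated
mass at least [c := 12^-1 * l `^ s], while summing over the children bounds
the total by [\sum (r k `^ s + c / g * r k)] over the sets that touch the
parent.  As [r k <= L `^ (1 - s) * r k `^ s], lightness of the parent makes the
second part at most [12^-1 * L * c / g], half of what [L / (6 g)] children would
require; what remains is [l `^ s <= 12 * g * L `^ (s - 1)], which
ubiquity of [G] excludes. *)
Lemma light_child s G V r a L : 0 < s < 1 -> ubiquitous s G -> 0 < L ->
    (forall k, 0 < r k) ->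
    (forall k x y, V k x -> V k y -> `|x - y| <= r k) ->
    light V r s a L ->
  exists b l, [/\ 0 < l <= L / 2, a <= b, b + l <= a + L,
    (forall x, b <= x <= b + l -> G x) & light V r s b l].
Proof.
move=> /andP[s0 s1] uG L0 r0 Vr lightL.
(* [6 / L] forces [6 g <= L], so that there are many cells; [13] beats the
   constant [12] of the final inequality. *)
pose M := 6 / L + 13 * L `^ (s - 1) + 1.
have Ls : 0 < L `^ (s - 1) by exact: powR_gt0.
have L60 : 0 < 6 / L by rewrite divr_gt0.
have M0 : 0 < M by rewrite /M; lra.
have [g [l [/andP[l0 lg] Mg Mg1 cell]]] := uG _ M0.
have g0 : 0 < g by exact: lt_le_trans lg.
have gL : 6 * g <= L.
  have : 6 / L * g <= 1.
    by apply: le_trans Mg1; rewrite ler_pM2r// /M; lra.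
  by rewrite mulrAC ler_pdivrMr// mul1r.
pose N := Num.truncn (L / (3 * g)).
have g30 : 0 < 3 * g by lra.
have Lg0 : 0 <= L / (3 * g) by rewrite divr_ge0// ltW.
have /andP[N1 N2] := truncn_itv Lg0; rewrite -/N in N1 N2.
have N3 : L / (6 * g) <= N%:R.
  have e : L / (3 * g) = L / (6 * g) *+ 2 by field; lra.
  have : 1 <= L / (6 * g) by rewrite ler_pdivlMr ?mul1r// mulr_gt0.
  by move: N2; rewrite -(natr1 N) e; lra.
rewrite ler_pdivlMr// in N1.
have /choice[y yP] : forall i : nat, exists y,
      (a + 3 * g * i%:R <= y <= a + 3 * g * i%:R + g) /\
      (forall x, y <= x <= y + l -> G x).
  by move=> i; have [y] := cell (a + 3 * g * i%:R); exists y.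
have ya i := (yP i).1; have yG i := (yP i).2.
have inI i : (i < N)%N -> a <= y i /\ y i + l <= a + L.
  move=> iN; have /andP[h1 h2] := ya i.
  have : 3 * g * i.+1%:R <= N%:R * (3 * g) by rewrite mulrC ler_pM2r// ler_nat.
  have : 0 <= 3 * g * i%:R by rewrite mulr_ge0// ltW.
  by rewrite -(natr1 i); lra.
suff [i iN lighti] : exists2 i, (i < N)%N & light V r s (y i) l.
  have [ay yL] := inI i iN.
  by exists (y i), l; split => //; [rewrite l0/=; lra|exact: yG].
apply: contrapT => /forall2NP heavy.
pose c := 12^-1 * l `^ s.
have c0 : 0 < c by rewrite mulr_gt0// powR_gt0.
have /choice[K KP] : forall i : nat, exists K, (i < N)%N ->
   c < \sum_(k < K | `[< meets V (y i) l k >]) r k `^ s.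
  move=> i; have [//|] := heavy i; first by exists 0%N.
  by move=> /existsNP[K /negP]; rewrite -ltNge => h; exists K.
pose K' := \max_(i < N) K i.
have rs0 k : 0 <= r k `^ s by exact: powR_ge0.
have cP i : (i < N)%N -> c <= \sum_(k < K' | `[< meets V (y i) l k >]) Num.min (r k `^ s) c.
  move=> iN; apply: le_trans (min_sum_le _ _ _ _) => //; last exact: ltW.
  rewrite le_min lexx andbT; apply: (le_trans (ltW (KP i iN))).
  have KK : (K i <= K')%N by exact: (@leq_bigmax _ (fun i : 'I_N => K i) (Ordinal iN)).
  rewrite -(big_mkord (fun k => `[< meets V (y i) l k >]) (fun k => r k `^ s)).
  rewrite -(big_mkord (fun k => `[< meets V (y i) l k >]) (fun k => r k `^ s)).
  by rewrite [leRHS](big_cat_nat (leq0n _) KK)/= lerDl sumr_ge0.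
have tot : N%:R * c <= \sum_(k < K' | `[< meets V a L k >]) (r k `^ s + c / g * r k).
  apply: (@le_trans _ _ (\sum_(i < N)
      \sum_(k < K' | `[< meets V (y i) l k >]) Num.min (r k `^ s) c)).
    rewrite mulrC mulr_natr -[X in _ *+ X]card_ord -sumr_const.
    by apply: ler_sum => i _; exact: cP.
  rewrite (exchange_big_dep (fun k : 'I_K' => `[< meets V a L k >]))/=; last first.
    move=> i k _ /asboolP[x /andP[x1 x2] Vx]; apply/asboolP; exists x => //.
    by have [] := inI i (ltn_ord i); lra.
  apply: ler_sum => k _; rewrite sumr_const -mulr_natl.
  have cnt : #|[set i : 'I_N | `[< meets V (y i) l k >]]%SET|%:R <= 1 + r k / g.
    apply: card_ord_spread; first by rewrite divr_ge0 ?ltW.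
    move=> i j; rewrite !finset.in_set => /asboolP[u /andP[u1 u2] Vu]
      /asboolP[v /andP[v1 v2] Vv] ij.
    rewrite ler_pdivlMr// natrB//.
    have := Vr _ _ _ Vv Vu => /(le_trans (ler_norm _)).
    have /andP[? ?] := ya i; have /andP[? ?] := ya j.
    have [->|ij1] := eqVneq (i : nat) j; first by rewrite subrr mul0r => _; exact: ltW.
    have : i%:R + 1 <= j%:R :> R by rewrite natr1 ler_nat ltn_neqAle ij1.
    (* points of cells [i < j] are at distance at least [3 g (j - i) - 2 g] *)
    nra.
  rewrite cardsE in cnt.
  apply: le_trans (ler_wpM2r _ cnt) _; first by rewrite le_min rs0 ltW.
  rewrite mulrDl mul1r [X in _ + X]mulrAC.
  apply: lerD; first by rewrite ge_min lexx.
  rewrite [leRHS]mulrC mulrA ler_pM2r ?invr_gt0// ler_pM2l//.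
  by rewrite ge_min lexx orbT.
have rL (k : 'I_K') : `[< meets V a L k >] -> r k <= L `^ (1 - s) * r k `^ s.
  move=> /asboolP/(light_meets s0 L0 r0 lightL) rk.
  have e : r k = r k `^ (1 - s) * r k `^ s.
    by rewrite -powRD ?subrK ?powRr1 ?ltW// gt_eqF ?implybT.
  rewrite {1}e ler_wpM2r//.
  by apply: ge0_ler_powR; rewrite ?nnegrE ?subr_ge0// ltW.
have cg : 0 <= c / g by rewrite divr_ge0 ?ltW.
have {}tot : N%:R * c <= (1 + c / g * L `^ (1 - s)) * (12^-1 * L `^ s).
  have pos : 0 <= 1 + c / g * L `^ (1 - s) by rewrite addr_ge0// mulr_ge0// powR_ge0.
  apply: (le_trans tot); apply: le_trans (ler_wpM2l pos (lightL K')).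
  rewrite big_distrr/=; apply: ler_sum => k kV.
  by rewrite mulrDl mul1r lerD2l -(mulrA (c / g)) ler_wpM2l ?rL.
have Lss : L `^ (1 - s) * L `^ s = L.
  by rewrite -powRD ?subrK ?powRr1 ?ltW// gt_eqF ?implybT.
have Ls1 : L `^ (s - 1) * L = L `^ s.
  by rewrite -{2}(powRr1 (ltW L0)) -powRD ?subrK// gt_eqF ?implybT.
have {}Mg : 13 * L `^ (s - 1) * g < l `^ s.
  apply: lt_le_trans Mg; rewrite ltr_pM2r// /M; lra.
move: N3; rewrite ler_pdivrMr ?mulr_gt0// => N3.
have {tot} : N%:R * (12^-1 * l `^ s) * g <= 12^-1 * L `^ s * g + 12^-1 * l `^ s * L / 12.
  rewrite -/c; apply: le_trans (ler_wpM2r (ltW g0) tot) _.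
  have -> : (1 + c / g * L `^ (1 - s)) * (12^-1 * L `^ s) * g =
      12^-1 * L `^ s * g + c * (L `^ (1 - s) * L `^ s) / 12 by field; lra.
  by rewrite Lss.
set ls := l `^ s in Mg *; rewrite -Ls1.
set P := L `^ (s - 1) in Mg *.
have ls0 : 0 < ls by exact: powR_gt0.
have : L * ls <= N%:R * (6 * g) * ls by rewrite ler_pM2r.
have : 13 * P * g * L < ls * L by rewrite ltr_pM2r.
have : 0 < P * g * L by rewrite !mulr_gt0.
nra.
Qed.

(** Iterating [light_child] gives nested light intervals, the [n]-th step landing
in [G n].  Their common point lies in every [G n]; a cover set through that
point would touch all the intervals, so its diameter bound [r k] would be
smaller than all their lengths, contradicting [0 < r k]. *)
Lemma ubiquitous_avoid s (G : nat -> set R) V r a L : 0 < s < 1 ->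
    (forall n, ubiquitous s (G n)) -> 0 < L -> (forall k, 0 < r k) ->
    (forall k x y, V k x -> V k y -> `|x - y| <= r k) ->
    light V r s a L ->
  exists2 x, a <= x <= a + L & (forall n, G n x) /\ (forall k, ~ V k x).
Proof.
move=> s01 uG L0 r0 Vr lightL; have /andP[s0 _] := s01.
(* The step is made total, with a junk value when the interval is not light, so
   that it can be iterated as a plain function. *)
have /choice[f fP] : forall u : nat * (R * R), exists v : R * R,
    0 < u.2.2 -> light V r s u.2.1 u.2.2 ->
    [/\ 0 < v.2 <= u.2.2 / 2, u.2.1 <= v.1, v.1 + v.2 <= u.2.1 + u.2.2,
      (forall x, v.1 <= x <= v.1 + v.2 -> G u.1 x) & light V r s v.1 v.2].
  move=> [n [b l]] /=.
  have [l0|l0] := ltP 0 l; last by exists (b, l).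
  have [lightl|nlightl] := pselect (light V r s b l); last by exists (b, l).
  by have [b' [l' ?]] := light_child s01 (uG n) l0 r0 Vr lightl; exists (b', l').
pose fix p n := if n is n'.+1 then f (n', p n') else (a, L).
have pP n : 0 < (p n).2 /\ light V r s (p n).1 (p n).2.
  elim: n => [//|n [IH1 IH2]].
  by have [/andP[-> _] _ _ _ ?] := fP (n, p n) IH1 IH2.
have {}fP n := fP (n, p n) (pP n).1 (pP n).2.
have p1 : {homo (fun n => (p n).1) : i j / (i <= j)%N >-> i <= j}.
  apply: homo_leq => // [u v w|n]; first exact: le_trans.
  by have [] := fP n.
have p2 : {homo (fun n => (p n).1 + (p n).2) : i j / (i <= j)%N >-> j <= i}.
  apply: (@homo_leq _ _ (fun u v => v <= u)) => [u|u v w h1 h2|n] //.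
    exact: le_trans h2 h1.
  by have [] := fP n.
have p12 i j : (p i).1 <= (p j).1 + (p j).2.
  apply: (@le_trans _ _ (p (maxn i j)).1); first by apply: p1; rewrite leq_maxl.
  apply: (@le_trans _ _ ((p (maxn i j)).1 + (p (maxn i j)).2)).
    by rewrite lerDl ltW//; case: (pP (maxn i j)).
  by apply: p2; rewrite leq_maxr.
pose x := sup (range (fun n => (p n).1)).
have xin n : (p n).1 <= x <= (p n).1 + (p n).2.
  apply/andP; split.
    apply: ub_le_sup; last by exists n.
    by exists ((p 0%N).1 + (p 0%N).2) => _ [i _ <-].
  by apply: ge_sup => [|_ [i _ <-]//]; exists (p 0%N).1, 0%N.
exists x; first exact: (xin 0%N).
split=> [n|k Vx]; first by have [_ _ _ + _] := fP n; apply; exact: (xin n.+1).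
have rp n : r k <= L / 2 ^+ n.
  apply: (@le_trans _ _ (p n).2).
    have [p0 lightp] := pP n; apply: (light_meets s0 p0 r0 lightp).
    by exists x => //; exact: xin.
  elim: n => [|n IH]; first by rewrite expr0 divr1.
  have [/andP[_ h] _ _ _ _] := fP n; apply: (le_trans h).
  by rewrite exprSr invfM mulrA ler_pM2r.
have := rp (Num.truncn (L / r k)); apply/negP; rewrite -ltNge.
have Lr : 0 <= L / r k by rewrite divr_ge0 ?ltW.
have /andP[_ h] := truncn_itv Lr.
rewrite ltr_pdivrMr ?exprn_gt0// mulrC -ltr_pdivrMr//; apply: (lt_le_trans h).
by rewrite -natrX ler_nat; exact: ltn_expl.
Qed.

End Avoidance.

(** * Diophantine approximation and distribution of multiples *)

Section Dirichlet.
Variable R : realType.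
Implicit Types (alpha x y : R).

(** Pigeonhole on the fractional parts of the first multiples of [alpha]. *)
Lemma dirichlet alpha (n : nat) : (0 < n)%N ->
  exists q (z : int), (0 < q <= n)%N /\ `|q%:R * alpha - z%:~R| < n%:R^-1.
Proof.
move=> n0; have n0R : 0 < n%:R :> R by rewrite ltr0n.
pose fl i : int := Num.floor (i%:R * alpha).
pose fr i : R := i%:R * alpha - (fl i)%:~R.
have fr01 i : 0 <= fr i < 1.
  by rewrite subr_ge0 floor_le ltrBlDl/= -[1]/(1%:~R) -intrD floorD1_gt.
have box i : (Num.truncn (n%:R * fr i) < n)%N.
  have /andP[h0 h1] := fr01 i.
  rewrite truncn_lt_nat ?mulr_ge0//.
  by rewrite gtr_pMr.
pose b (i : 'I_n.+1) : 'I_n := Ordinal (box i).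
have /injectivePn[i [j ij bij]] : ~~ injectiveb b.
  by apply/negP => /injectiveP/leq_card; rewrite !card_ord ltnn.
wlog {ij} ij : i j bij / (i < j)%N.
  move=> h; have := ij; rewrite -(inj_eq val_inj)/= neq_ltn => /orP[ltij|ltji].
    exact: (h i j).
  exact: (h j i).
exists (j - i)%N, (fl j - fl i); split.
  by rewrite subn_gt0 ij/= (leq_trans (leq_subr _ _))// -ltnS.
have -> : (j - i)%N%:R * alpha - (fl j - fl i)%:~R = fr j - fr i.
  by rewrite natrB 1?ltnW// intrB /fr; ring.
have trP k : (Num.truncn (n%:R * fr k))%:R <= n%:R * fr k < (Num.truncn (n%:R * fr k)).+1%:R.
  by apply: truncn_itv; rewrite mulr_ge0//; have /andP[] := fr01 k.
have := trP i; have := trP j.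
have -> : Num.truncn (n%:R * fr i) = Num.truncn (n%:R * fr j).
  by have /(congr1 val) := bij.
rewrite -natr1 => /andP[h1 h2] /andP[h3 h4].
by rewrite -(ltr_pM2l n0R) divff ?gt_eqF// -{1}(gtr0_norm n0R) -normrM ltr_norml; lra.
Qed.

Lemma irrational_nat_mul_neq alpha (q : nat) (z : int) : irrational alpha ->
  (0 < q)%N -> q%:R * alpha != z%:~R.
Proof.
move=> airr q0; apply/negP => /eqP e; apply: airr.
exists (z%:~R / q%:R); first by [].
by rewrite rmorphM/= fmorphV/= ratr_int ratr_nat -e mulrAC divff ?mul1r// pnatr_eq0 -lt0n.
Qed.

(** This is what makes the denominators of good approximations tend to
infinity. *)
Lemma irrational_nat_mul_far alpha (n : nat) : irrational alpha ->
  exists2 e : R, 0 < e & forall q (z : int), (0 < q <= n)%N -> e <= `|q%:R * alpha - z%:~R|.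
Proof.
move=> airr; elim: n => [|n [e e0 IH]].
  by exists 1 => // q z /andP[]; case: q.
have d0 : 0 < dist_to_int (n.+1%:R * alpha).
  rewrite lt_def dist_to_int_ge0 dist_to_int_eq0 andbT; apply/negP => /intrP[z /eqP].
  by apply/negP; exact: irrational_nat_mul_neq.
exists (Num.min e (dist_to_int (n.+1%:R * alpha))); first by rewrite lt_min e0.
move=> q z /andP[q0]; rewrite leq_eqVlt => /orP[/eqP ->|qn]; rewrite ge_min.
  by rewrite dist_to_int_le orbT.
by rewrite IH// q0.
Qed.

(** Dividing a Dirichlet approximation by the common factor keeps the error below
the same bound, and that bound, chosen below all the errors of denominators up
to [n], rules these denominators out. *)
Lemma coprime_approximation alpha (n : nat) : irrational alpha ->
  exists q (z : int), [/\ (n < q)%N, coprimez z q & `|q%:R * alpha - z%:~R| <= q%:R^-1].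
Proof.
move=> airr; have [e e0 far] := irrational_nat_mul_far n airr.
pose N := (Num.truncn e^-1).+1.
have Ne : N%:R^-1 < e.
  rewrite -[ltRHS]invrK ltf_pV2 ?posrE ?invr_gt0 ?ltr0n//.
  by have /andP[] := truncn_itv (ltW (etrans (invr_gt0 e) e0)).
have [q [z [/andP[q0 qN] qz]]] := dirichlet alpha (isT : (0 < N)%N).
pose d := gcdn `|z| q.
have d0 : (0 < d)%N by rewrite gcdn_gt0 q0 orbT.
have dR : 0 < d%:R :> R by rewrite ltr0n.
have [q' dq] : exists q', q = (q' * d)%N by apply/dvdnP; exact: dvdn_gcdr.
have [z' dz] : exists z', z = z' * d%:Z by apply: (elimT (@dvdzP d z)); exact: dvdn_gcdl.
have q'0 : (0 < q')%N by move: q0; rewrite dq muln_gt0 => /andP[].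
have q'q : (q' <= q)%N by rewrite dq leq_pmulr.
have qz' : `|q'%:R * alpha - z'%:~R| < N%:R^-1.
  apply: le_lt_trans qz; rewrite dq dz natrM intrM -(pmulrn 1 d).
  have -> : q'%:R * d%:R * alpha - z'%:~R * d%:R = (q'%:R * alpha - z'%:~R) * d%:R by ring.
  by rewrite normrM ler_peMr// gtr0_norm// ler1n.
exists q', z'; split.
- rewrite ltnNge; apply/negP => q'n.
  by have := far q' z'; rewrite q'0 q'n => /(_ isT); rewrite leNgt (lt_trans qz' Ne).
- rewrite coprimezE /coprime -(eqn_pmul2r d0)/= mul1n muln_gcdl -dq.
  by rewrite -[X in (_ * X)%N]absz_nat -abszM -dz.
- apply: (le_trans (ltW qz')).
  by rewrite lef_pV2 ?posrE ?ltr0n// ler_nat (leq_trans q'q).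
Qed.

(** Since [z] is invertible modulo [q], the numbers [k z / q] for [q <= k < 2 q]
run through all multiples of [q^-1] modulo 1, and each [k alpha] stays within
[2 / q] of [k z / q]; rounding the target [y] to a multiple of [q^-1] costs at
most another [1 / q]. *)
Lemma equidistributed_multiples alpha (q : nat) (z : int) y : (0 < q)%N ->
  coprimez z q -> `|q%:R * alpha - z%:~R| <= q%:R^-1 ->
  exists k (j : int), (q <= k < q + q)%N /\ `|k%:R * alpha + y - j%:~R| <= 3 / q%:R.
Proof.
move=> q0 /coprimezP[[u v] /= uv] qz.
have qR : 0 < q%:R :> R by rewrite ltr0n.
pose w := Num.floor (q%:R * y).
have /andP[w0 w1] : w%:~R <= q%:R * y < w%:~R + 1.
  by rewrite floor_le -[1]/(1%:~R) -intrD floorD1_gt.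
(* chosen so that [z * k = - w] modulo [q], where [w / q] approximates [y] *)
pose t := (- w * u %% q)%Z.
have qn0 : (q : int) != 0 by rewrite eqz_nat -lt0n.
have t0 : 0 <= t by exact: modz_ge0.
have tq : t < q by exact: ltz_pmod.
pose k := (q + `|t|)%N.
have kE : k = q%:Z + t :> int by rewrite PoszD gez0_abs.
have [j jE] : exists j : int, z * k%:Z + w = j * q%:Z.
  exists (z + v * w - z * (- w * u %/ q)%Z).
  have := divz_eq (- w * u) q; rewrite -/t => tE.
  have {}tE : t = - w * u - (- w * u %/ q)%Z * q by rewrite {1}tE addrAC subrr add0r.
  have {1}<- : w * (u * z + v * q) = w by rewrite uv mulr1.
  by rewrite kE tE; ring.
have kq : (k <= 2 * q)%N by rewrite -lez_nat kE; lia.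
exists k, j; split; first by lia.
have jR : j%:~R = (z%:~R * k%:R + w%:~R) / q%:R :> R.
  apply: (canRL (mulfK _)); first by rewrite gt_eqF.
  by have := congr1 (fun i : int => i%:~R : R) jE; rewrite intrD !intrM => <-.
have -> : k%:R * alpha + y - j%:~R =
    (k%:R * (q%:R * alpha - z%:~R) + (q%:R * y - w%:~R)) / q%:R.
  by rewrite jR; field; rewrite gt_eqF.
rewrite normrM normfV (gtr0_norm qR) ler_pM2r ?invr_gt0//.
apply: le_trans (ler_normD _ _) _; rewrite (_ : 3 = 2 + 1 :> R); last by ring.
apply: lerD; last by rewrite ger0_norm; lra.
rewrite normrM normr_nat; apply: (@le_trans _ _ ((2 * q)%:R / q%:R)).
  by rewrite ler_pM// ler_nat.
by rewrite natrM mulfK ?gt_eqF.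
Qed.

End Dirichlet.

(** * Ubiquity of the approximation sets *)

Section Targets.
Variable R : realType.
Implicit Types (alpha x y mu omega s e c : R).

Definition has_sign (b : bool) (p : int) := if b then p < 0 else 0 < p.

(** One approximation of size at least [n] by an integer in a given class and of
a given sign: the tail sets whose intersection over all
[n] expresses that there are infinitely many such integers. *)
Definition hit_beyond mu omega (l m : nat) (b : bool) (n : nat) : set R :=
  [set x | exists p : int, [/\ (n <= `|p|)%N, has_sign b p, (p = l %[mod m])%Z &
    dist_to_int (x + p%:~R * omega) < `|p%:~R| `^ (- mu)]].

Lemma irrationalMz omega (z : int) : irrational omega -> z != 0 ->
  irrational (z%:~R * omega).
Proof.
move=> oirr z0 [r _ rE]; apply: oirr; exists (r / z%:~R) => //.
by rewrite rmorphM/= fmorphV/= ratr_int rE mulrC mulKf// intr_eq0.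
Qed.

Lemma powR_eventually_ge e c : 0 < e ->
  exists n : nat, forall q : nat, (n <= q)%N -> c <= q%:R `^ e.
Proof.
move=> e0; have [c0|c0] := leP c 0.
  by exists 0%N => q _; apply: (le_trans c0); exact: powR_ge0.
exists (Num.truncn (c `^ e^-1)).+1 => q nq.
have cE : c = (c `^ e^-1) `^ e by rewrite -powRrM mulVf ?powRr1 ?gt_eqF// ltW.
rewrite [leLHS]cE; apply: ge0_ler_powR; rewrite ?nnegrE ?powR_ge0 ?ler0n ?(ltW e0)//.
have /andP[_ h] := truncn_itv (powR_ge0 c e^-1).
by rewrite (le_trans (ltW h))// ler_nat.
Qed.

Lemma progression_term (l m n q k : nat) (b : bool)
    (p := l%:Z + (if b then -1 else 1) * m%:Z * k%:Z) :
    (l < m)%N -> (n < q)%N -> (q <= k < q + q)%N ->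
  [/\ (n <= `|p|)%N, has_sign b p, (p = l %[mod m])%Z & (`|p| <= 2 * m * q)%N].
Proof.
move=> lm nq /andP[qk kq].
have h1 : (k.-1 <= m * k.-1)%N by apply: leq_pmull; lia.
have h2 : (m * k = m * k.-1 + m)%N by rewrite -mulnSr prednK//; lia.
have h3 : (m * k + m <= 2 * m * q)%N.
  by rewrite -mulnSr mulnAC [(2 * q * m)%N]mulnC leq_mul2l; apply/orP; right; lia.
have pmod : (p = l %[mod m])%Z.
  by rewrite /p mulrAC -modzDmr modzMl addr0.
have pE : p = l%:Z + (if b then -1 else 1) * (m * k)%N%:Z.
  by rewrite /p PoszM mulrA.
rewrite /has_sign; move: p (m * k)%N (m * k.-1)%N pE pmod h1 h2 h3 => p' u v.
by case: b => pE pmod h1 h2 h3; split => //; clear pmod; lia.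
Qed.

(** The integers [l + m k] and [l - m k] turn the problem into the distribution of
the multiples of [alpha := m omega] or [- m omega].  With [q] the denominator
of a good approximation of [alpha], the points at which [x + p omega] is an
integer, for [q <= k < 2 q], meet every interval of length [6 / q]; as
[|p| <= 2 m q], the interval of length half of [(2 m q) `^ (- mu)] to the right
of such a point consists of admissible [x].  Comparing lengths, one needs
[q `^ (1 - mu * s)] large, which holds for large [q]. *)
Lemma ubiquitous_hit_beyond mu omega (l m : nat) b n s :
    irrational omega -> 1 < mu -> (l < m)%N -> 0 < s -> mu * s < 1 ->
  ubiquitous s (hit_beyond mu omega l m b n).
Proof.
move=> oirr mu1 lm s0 mus M M0.
have m0 : (0 < m)%N by exact: leq_ltn_trans lm.
pose sg : int := if b then -1 else 1.
pose alpha := (sg * m%:Z)%:~R * omega.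
have airr : irrational alpha.
  by apply: irrationalMz => //; rewrite mulf_neq0//; [rewrite /sg; case: (b)|rewrite eqz_nat -lt0n].
pose c := (2 * m)%:R `^ (- mu * s) * 2^-1 `^ s : R.
have c0 : 0 < c by rewrite mulr_gt0 ?powR_gt0// ltr0n muln_gt0.
have [n1 n1P] := powR_eventually_ge (6 * M) (@ltr01 R).
have [n2 n2P] : exists n2 : nat, forall q : nat, (n2 <= q)%N -> 6 * M / c <= q%:R `^ (1 - mu * s).
  by apply: powR_eventually_ge; rewrite subr_gt0.
have [q [z [nq zq qz]]] := coprime_approximation (n + n1 + n2).+1 airr.
have q0 : (0 < q)%N by exact: leq_trans nq.
have qR : 0 < q%:R :> R by rewrite ltr0n.
pose P : R := (2 * m * q)%:R.
have P0 : 0 < P by rewrite ltr0n !muln_gt0 m0 q0.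
pose d := P `^ (- mu).
have d0 : 0 < d by exact: powR_gt0.
have qV : 0 < q%:R^-1 :> R by rewrite invr_gt0.
exists (6 / q%:R), (d * 2^-1); split.
- rewrite divr_gt0//=.
  suff : d <= q%:R^-1 by lra.
  rewrite /d powRN lef_pV2 ?posrE ?powR_gt0//.
  have P1 : 1 <= P by rewrite ler1n !muln_gt0 m0 q0.
  apply: (@le_trans _ _ P); last by rewrite -{1}(powRr1 (ltW P0)) ler_powR// ltW.
  by rewrite ler_nat leq_pmull// muln_gt0.
- rewrite powRM ?(ltW d0)// /d -powRrM /P natrM powRM// -mulrA [_ * 2^-1 `^ s]mulrC mulrA.
  rewrite !mulrA -/c ler_pdivrMr// -mulrA -{2}(powRr1 (ltW qR)) -powRD; last first.
    by rewrite (gt_eqF qR) implybT.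
  rewrite [M * 6]mulrC [leRHS]mulrC -ler_pdivrMr//.
  have -> : - mu * s + 1 = 1 - mu * s by ring.
  by apply: n2P; apply: leq_trans (ltnW (ltnW nq)); rewrite leq_addl.
- rewrite mulrA ler_pdivrMr// mul1r mulrC -[leRHS]powRr1; last exact: ltW.
  apply: n1P; apply: leq_trans (ltnW (ltnW nq)).
  by rewrite addnAC leq_addl.
- move=> a.
  have [k [j [/andP[k1 k2] kj]]] :=
    equidistributed_multiples (l%:R * omega + (a + 3 / q%:R)) q0 zq qz.
  pose p : int := l%:Z + sg * m%:Z * k%:Z.
  have pE : p%:~R * omega = l%:R * omega + k%:R * alpha.
    by rewrite /p /alpha intrD !intrM -!pmulrn; ring.
  have [||pn ps pm pP] := @progression_term l m n q k b lm.
  - by apply: leq_trans (ltnW nq); rewrite ltnS -addnA leq_addr.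
  - by rewrite k1.
  exists (j%:~R - p%:~R * omega).
    by move: kj; rewrite ler_norml pE; lra.
  move=> x /andP[x1 x2]; exists p; split => //.
  apply: le_lt_trans (dist_to_int_le _ j) _.
  apply: (@lt_le_trans _ _ d).
    by rewrite ger0_norm; lra.
  have p0 : 0 < `|p%:~R| :> R.
    rewrite normr_gt0 intr_eq0; move: ps; rewrite /has_sign.
    by case: ifP => _ p0; rewrite neq_lt p0 ?orbT.
  rewrite /d !powRN lef_pV2 ?posrE ?powR_gt0//.
  apply: ge0_ler_powR; rewrite ?nnegrE ?(ltW P0) ?(ltW p0)//; first by lra.
  by rewrite -intr_norm -abszE -pmulrn ler_nat.
Qed.

End Targets.

(** * Upper bound for Hausdorff measures of limsup sets *)

Section PSeries.
Variable R : realType.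

(** Pairing the terms of ranks [2 k] and [2 k + 1] shows that a partial sum of double
length is at most [1 + r * S], where [S] is the original partial sum and
[r := 2 `^ (1 - a)]; as partial sums increase, [S <= 1 + r * S] with [r < 1]. *)
Lemma p_series_partial_sum_le (a : R) (K : nat) : 1 < a ->
  \sum_(k < K) k.+1%:R `^ (- a) <= (1 - 2 `^ (1 - a))^-1.
Proof.
move=> a1; pose f k : R := k.+1%:R `^ (- a); pose r : R := 2 `^ (1 - a).
have fdec i j : (i <= j)%N -> f j <= f i.
  move=> ij; rewrite /f !powRN lef_pV2 ?posrE ?powR_gt0//.
  apply: ge0_ler_powR; rewrite ?nnegrE//; first by lra.
  by rewrite ler_nat.
have f0 k : 0 <= f k by exact: powR_ge0.
have r1 : r < 1.
  have -> : r = (2 `^ (a - 1))^-1 by rewrite -powRN opprB.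
  rewrite invf_lt1 ?powR_gt0//.
  have : 1 `^ (a - 1) < 2 `^ (a - 1).
    by apply: gt0_ltr_powR; rewrite ?nnegrE ?subr_gt0// ltr1n.
  by rewrite powR1.
have half n : \sum_(k < n.*2.+1) f k <= 1 + r * \sum_(k < n) f k.
  elim: n => [|n IH]; first by rewrite big_ord1 big_ord0 /f powR1 mulr0 addr0.
  rewrite doubleS !big_ord_recr/= in IH *.
  have rf : r * f n = f n.*2.+1 + f n.*2.+1.
    have -> : f n.*2.+1 = 2 `^ (- a) * f n.
      by rewrite /f -powRM ?ler0n// -natrM mul2n doubleS.
    by rewrite /r powRD ?powRr1// ?pnatr_eq0 ?implybT//; ring.
  have := fdec _ _ (leqnSn n.*2.+1); rewrite mulrDr rf; lra.
have mono : \sum_(k < K) f k <= \sum_(k < K.*2.+1) f k.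
  have KK : (K <= K.*2.+1)%N by rewrite -addnn -addnS leq_addr.
  rewrite -!(big_mkord predT f) [leRHS](big_cat_nat (leq0n K) KK)/=.
  by rewrite lerDl sumr_ge0.
have := le_trans mono (half K).
rewrite -[(1 - _)^-1]mul1r ler_pdivlMr ?subr_gt0//.
by rewrite -/r mulrBr mulr1 lerBlDr mulrC.
Qed.

End PSeries.

Section Hausdorff.
Context {R : realType} {M : metricType R}.
Implicit Types (A U : set M) (s delta : R).
Local Open Scope ereal_scope.

Lemma mdist_le_diam U (x y : M) : U x -> U y -> (mdist x y)%:E <= diam U.
Proof. by move=> Ux Uy; apply: ereal_sup_ubound; exists (x, y). Qed.

Lemma diam_ge0 U : U !=set0 -> 0 <= diam U.
Proof.
move=> [x Ux]; apply: le_trans (mdist_le_diam Ux Ux).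
by rewrite lee_fin; exact: mdist_ge0.
Qed.

Lemma diam_le U (d : R) : (forall x y, U x -> U y -> (mdist x y <= d)%R) ->
  diam U <= d%:E.
Proof. by move=> Ud; apply: ge_ereal_sup => _ [[x y] [Ux Uy] <-]; rewrite lee_fin; exact: Ud. Qed.

Lemma diam_pow_ge0 s U : 0 <= diam_pow s U.
Proof. by rewrite /diam_pow; case: ifP => // _; exact: poweR_ge0. Qed.

Lemma diam_pow_le s U (d : R) : (0 < s)%R -> (0 <= d)%R -> diam U <= d%:E ->
  diam_pow s U <= (d `^ s)%:E.
Proof.
move=> s0 d0 Ud; rewrite /diam_pow; case: ifPn => [_|/set0P U0].
  by rewrite lee_fin powR_ge0.
rewrite -poweR_EFin; apply: gt0_ler_poweR => //; first exact: ltW.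
- by rewrite in_itv/= diam_ge0// leey.
- by rewrite in_itv/= lee_fin d0 leey.
Qed.

(** Replaces the extended-real term of a cover by a real diameter bound, and at
the same time raises the exponent, so that lower bounds need only treat
positive exponents. *)
Lemma diam_pow_witness s s' U : (0 < s')%R -> (s <= s')%R -> diam U <= 1 ->
  exists d : R, [/\ (0 <= d)%R, forall x y, U x -> U y -> (mdist x y <= d)%R &
    (d `^ s')%:E <= diam_pow s U].
Proof.
move=> s'0 ss' U1; have [->|/set0P U0] := eqVneq U set0.
  by exists 0%R; rewrite powR0 ?gt_eqF// diam_pow_ge0.
have Ufin : diam U \is a fin_num.
  by rewrite ge0_fin_numE ?diam_ge0// (le_lt_trans U1) ?ltry.
exists (fine (diam U)); split.
- by rewrite fine_ge0// diam_ge0.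
- by move=> x y Ux Uy; rewrite -lee_fin fineK//; exact: mdist_le_diam.
rewrite /diam_pow ifF; last by apply/negbTE/set0P.
rewrite -{2}(fineK Ufin) poweR_EFin lee_fin.
have : (0 <= fine (diam U))%R by rewrite fine_ge0// diam_ge0.
rewrite le_eqVlt => /predU1P[<-|d0]; first by rewrite powR0 ?gt_eqF// powR_ge0.
by apply: ger_powR => //; rewrite d0/= -lee_fin fineK.
Qed.

Lemma hausdorff_premeasure_ge0 s delta A : 0 <= hausdorff_premeasure s delta A.
Proof.
apply: le_ereal_inf_tmp => _ [U _ <-]; apply: nneseries_ge0 => *.
exact: diam_pow_ge0.
Qed.

(** Hausdorff-Cantelli lemma: the tails of a summable sequence of sets cover their
limsup set with arbitrarily small total mass.  A tail below [delta `^ s] also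
has all its diameters below [delta]. *)
Lemma hausdorff_measure_limsup0 s (d : nat -> R) (W : nat -> set M) A :
    (0 < s)%R -> (forall k, (0 <= d k)%R) ->
    (forall k x y, W k x -> W k y -> (mdist x y <= d k)%R) ->
    \sum_(0 <= k <oo) (d k `^ s)%:E < +oo ->
    (forall N, A `<=` \bigcup_(k in [set k | (N <= k)%N]) W k) ->
  hausdorff_measure s A = 0.
Proof.
move=> s0 d0 Wd sumd AW; apply/eqP; rewrite eq_le; apply/andP; split; last first.
  apply: le_trans (hausdorff_premeasure_ge0 s 1 A) _.
  by apply: ereal_sup_ubound; exists 1%R => //=; exact: ltr01.
apply: ge_ereal_sup => _ [delta /= delta0 <-].
apply/lee_addgt0Pr => e e0; rewrite add0e.
have ds k : (0 <= d k `^ s)%R by exact: powR_ge0.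
pose e' := Num.min e (delta `^ s)%R.
have e'0 : (0 < e')%R by rewrite lt_min e0 powR_gt0.
have [N tailN] : exists N, \sum_(N <= k <oo) (d k `^ s)%:E < e'%:E.
  apply: contrapT => /forallNP tail_ge.
  have /(cvg_lim (@ereal_hausdorff R)) lim0 := nneseries_tail_cvg sumd (fun k _ => ds k).
  have : e'%:E <= limn (fun N => \sum_(N <= k <oo) (d k `^ s)%:E).
    apply: lime_ge.
      by apply: cvgP; exact: nneseries_tail_cvg sumd (fun k _ => ds k).
    by apply: nearW => N; rewrite leNgt; exact/negP/tail_ge.
  by rewrite lim0 lee_fin leNgt e'0.
have small k : (d (k + N)%N `^ s)%:E <= e'%:E.
  apply: le_trans (ltW tailN).
  apply: le_trans (nneseries_lim_ge (k + N).+1 _); last by move=> *; exact: ds.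
  rewrite big_nat_recr ?leq_addl//= leeDr// sume_ge0// => *; exact: ds.
apply: le_trans (ereal_inf_lbound _) _.
  exists (fun k => W (k + N)%N) => //; split => [k|x Ax].
    apply: diam_le => x y Wx Wy; apply: (le_trans (Wd _ _ _ Wx Wy)).
    rewrite leNgt; apply/negP => dd.
    have : (delta `^ s < d (k + N)%N `^ s)%R.
      by apply: gt0_ltr_powR; rewrite ?nnegrE// ltW.
    apply/negP; rewrite -leNgt -lee_fin; apply: le_trans (small k) _.
    by rewrite lee_fin ge_min lexx orbT.
  have [k /= Nk Wk] := AW N x Ax.
  by exists (k - N)%N => //=; rewrite subnK.
apply: (@le_trans _ _ (\sum_(0 <= k <oo) (d (k + N)%N `^ s)%:E)).
  apply: lee_nneseries => [*|k _]; first exact: diam_pow_ge0.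
  by apply: diam_pow_le => //; apply: diam_le; exact: Wd.
rewrite (@nneseries_addn _ (fun k => (d k `^ s)%:E))//.
by apply: (le_trans (ltW tailN)); rewrite lee_fin ge_min lexx.
Qed.

Lemma hausdorff_measure0_cover s s' A (e : R) : (0 < s')%R -> (s <= s')%R -> (0 < e)%R ->
  hausdorff_measure s A = 0 ->
  exists (d : nat -> R) (U : nat -> set M), [/\ (forall k, (0 <= d k)%R),
    (forall k x y, U k x -> U k y -> (mdist x y <= d k)%R),
    A `<=` \bigcup_k U k & forall K, (\sum_(k < K) d k `^ s' <= e)%R].
Proof.
move=> s'0 ss' e0 A0.
have : hausdorff_premeasure s 1 A < e%:E.
  rewrite (@le_lt_trans _ _ 0) ?lte_fin// -A0.
  by apply: ereal_sup_ubound; exists 1%R => //=; exact: ltr01.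
move=> /ereal_inf_lt[_ [U [U1 AU] <-] Ue].
have /choice[d dP] k := diam_pow_witness s'0 ss' (U1 k).
exists d, U; split => // [k|k|K]; [by have [] := dP k|by have [] := dP k|].
rewrite -lee_fin -sumEFin; apply: le_trans (ltW Ue).
apply: le_trans (nneseries_lim_ge K _); last by move=> *; exact: diam_pow_ge0.
by rewrite big_mkord; apply: lee_sum => k _; have [] := dP k.
Qed.

End Hausdorff.

(** * From the line to the circle *)

Section Circle.
Variable R : realType.
Implicit Types (x y mu omega s : R).

Lemma dist_to_int_small x : `|x| <= 2^-1 -> dist_to_int x = `|x|.
Proof.
move=> x2; apply/eqP; rewrite eq_le; apply/andP; split.
  by have := dist_to_int_le x 0; rewrite subr0.
have [k ->] := dist_to_int_attained x.
have [->|k0] := eqVneq k 0; first by rewrite subr0.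
have k1 : 1 <= `|k%:~R| :> R.
  by rewrite -intr_norm -[1]/(1%:~R) ler_int -gtz0_ge1 normr_gt0.
have : `|k%:~R| <= `|x| + `|x - k%:~R|.
  by rewrite -[in leLHS](subrK x k%:~R) addrC distrC; exact: ler_normD.
by lra.
Qed.

(** Half of the circle embeds isometrically in the line, which is why the lower
bound is proved inside the interval from [0] to [2^-1]. *)
Lemma mdist_pi x y : `|x - y| <= 2^-1 ->
  mdist (\pi_(circle R) x) (\pi_(circle R) y) = `|x - y|.
Proof.
move=> xy; have -> : mdist (\pi_(circle R) x) (\pi_(circle R) y) =
    circle_norm (\pi_(circle R) (y - x)) by rewrite circle_piD circle_piN.
by rewrite circle_norm_pi dist_to_int_small distrC.
Qed.

Lemma close_time_pi mu omega x (p : int) : close_time mu omega (\pi_(circle R) x) p =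
  (dist_to_int (x + p%:~R * omega) < `|p%:~R| `^ (- mu)) :> Prop.
Proof. by rewrite /close_time -circle_piD circle_norm_pi. Qed.

Lemma unbounded_infinite_set (S : set int) :
  (forall n, exists2 p, S p & (n <= `|p|)%N) -> infinite_set S.
Proof.
move=> Sunb /finite_fsetP[A SA].
have [p Sp] := Sunb (\max_(i <- A) `|i|%N).+1.
apply/negP; rewrite -leqNgt; apply: (leq_bigmax_seq (F := fun i : int => `|i|%N)) => //.
by move: Sp; rewrite SA.
Qed.

Lemma infinite_set_pos (S : set int) (n : nat) : (forall p, S p -> 0 < p) ->
  infinite_set S -> exists2 k : nat, (n <= k)%N & S k.
Proof.
move=> S0 Sinf; apply: contrapT => /forall2NP Sn; apply: Sinf.
apply: (@sub_finite_set _ _ (Posz @` `I_n)); last by apply: finite_image; exact: finite_II.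
move=> p Sp; exists `|p|%N; last by rewrite gez0_abs// ltW// S0.
have [/negP|] := Sn `|p|%N; first by rewrite -ltnNge.
by rewrite gez0_abs// ltW// S0.
Qed.

(** All residue classes, signs and size thresholds are interleaved in a single
sequence: the parity of [n] codes the sign and the half of [n] modulo [m] the
class, so each pair (class, sign) occurs for arbitrarily large [n]. *)
Lemma hit_beyond_approx_set mu omega (m : nat) x : (0 < m)%N ->
  (forall n, hit_beyond mu omega (n./2 %% m) m (odd n) n x) ->
  (\bigcap_(l in `I_m) approx_set mu omega l m) (\pi_(circle R) x).
Proof.
move=> m0 hit l /= lm.
have key b n : exists p : int, [/\ (n <= `|p|)%N, has_sign b p, (p = l %[mod m])%Z &
    dist_to_int (x + p%:~R * omega) < `|p%:~R| `^ (- mu)].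
  have := hit (b + (n * m + l).*2)%N.
  rewrite half_bit_double oddD odd_double addbF oddb modnMDl modn_small//.
  move=> [p [np ps pl xp]]; exists p; split => //; apply: leq_trans np.
  apply: leq_trans (leq_addl _ _); rewrite -addnn -addnA.
  by apply: leq_trans (leq_addr _ _); exact: leq_pmulr.
by split; apply: unbounded_infinite_set => n;
  [have [p [np ps pl xp]] := key false n|have [p [np ps pl xp]] := key true n];
  exists p => //; split => //; rewrite close_time_pi.
Qed.

(** The positive integers alone, in the class of 0, already give a cover by arcs
of length [2 p `^ (- mu)], and [\sum p `^ (- (mu * s))] converges. *)
Lemma hausdorff_measure_approx_set0 mu omega (m : nat) s : (0 < m)%N -> 0 < mu -> mu^-1 < s ->
  hausdorff_measure s (\bigcap_(l in `I_m) approx_set mu omega l m) = 0%E.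
Proof.
move=> m0 mu0 mus.
have s0 : 0 < s by apply: lt_trans mus; rewrite invr_gt0.
have mus1 : 1 < mu * s by rewrite mulrC -ltr_pdivrMr// mul1r.
pose d k : R := 2 * k.+1%:R `^ (- mu).
pose W k : set (circle R) := [set t | close_time mu omega t k.+1].
have d0 k : 0 <= d k by rewrite mulr_ge0// powR_ge0.
have dE k : d k `^ s = 2 `^ s * k.+1%:R `^ (- (mu * s)).
  by rewrite /d powRM ?powR_ge0// -powRrM mulNr.
apply: (@hausdorff_measure_limsup0 _ _ _ d W) => //.
- move=> k x y Wx Wy.
  have -> : mdist x y = circle_norm ((y + \pi_(circle R) (k.+1%:~R * omega))
      + - (x + \pi_(circle R) (k.+1%:~R * omega))).
    by rewrite opprD addrACA subrr addr0.
  apply: le_trans (circle_normD _ _) _; rewrite circle_normN.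
  rewrite /W /close_time /= -!pmulrn normr_nat in Wx Wy.
  rewrite -pmulrn /d mulrDl mul1r; apply: lerD; exact: ltW.
- set C := (1 - 2 `^ (1 - mu * s))^-1.
  apply: (@le_lt_trans _ _ (2 `^ s * C)%:E); last exact: ltry.
  apply: lime_le; first by apply: is_cvg_nneseries => k _ _; exact: powR_ge0.
  apply: nearW => n; rewrite sumEFin lee_fin big_mkord.
  under eq_bigr do rewrite dE.
  by rewrite -big_distrr/= ler_wpM2l ?powR_ge0//; exact: p_series_partial_sum_le.
- move=> N t At; have [Tinf _] := At 0%N m0.
  have [|k Nk [k0 _ tk]] := infinite_set_pos N.+1 _ Tinf; first by move=> p [].
  by exists k.-1; rewrite /W /= ?prednK//; lia.
Qed.

(** Vanishing of the measure yields a cover of small total mass, and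
[ubiquitous_avoid] produces a point of the set outside this cover. *)
Lemma hausdorff_measure_approx_set_neq0 mu omega (m : nat) s : irrational omega ->
    (0 < m)%N -> 1 < mu -> 0 <= s -> s < mu^-1 ->
  hausdorff_measure s (\bigcap_(l in `I_m) approx_set mu omega l m) != 0%E.
Proof.
move=> oirr m0 mu1 s0 smu; apply/negP => /eqP A0.
have mu0 : 0 < mu by lra.
have muV1 : mu^-1 < 1 by rewrite invf_lt1.
pose s' := (s + mu^-1) / 2.
have [s'0 ss' s'mu] : [/\ 0 < s', s <= s' & s' < mu^-1] by rewrite /s'; split; lra.
have mus' : mu * s' < 1 by rewrite mulrC -ltr_pdivlMr// mul1r.
pose L : R := 2^-1.
pose e := 24^-1 * L `^ s'.
have L0 : 0 < L by rewrite invr_gt0.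
have e0 : 0 < e by rewrite mulr_gt0 ?powR_gt0// invr_gt0.
have [d [U [d0 Ud AU sumd]]] := hausdorff_measure0_cover s'0 ss' e0 A0.
(* The diameter bounds are enlarged by a summable amount to become positive:
   a singleton costs nothing in the sum but has to be avoided as well. *)
pose r k := (d k `^ s' + e / 2 ^+ k.+1) `^ s'^-1.
have ek k : 0 < e / 2 ^+ k.+1 by rewrite divr_gt0.
have ds k : 0 <= d k `^ s' by exact: powR_ge0.
have rk k : 0 < r k by rewrite powR_gt0// ltr_wpDl.
have rs k : r k `^ s' = d k `^ s' + e / 2 ^+ k.+1.
  by rewrite -powRrM mulVf ?gt_eqF// powRr1// addr_ge0 ?(ltW (ek k)).
have dr k : d k <= r k.
  rewrite leNgt; apply/negP => rd.
  have : r k `^ s' < d k `^ s' by apply: gt0_ltr_powR; rewrite ?nnegrE ?(ltW (rk k)).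
  by rewrite rs; have := ek k; lra.
pose V k := [set x | 0 <= x <= L /\ U k (\pi_(circle R) x)].
have Vr k x y : V k x -> V k y -> `|x - y| <= r k.
  move=> [/andP[x0 xL] Ux] [/andP[y0 yL] Uy].
  rewrite -mdist_pi; first exact: le_trans (Ud _ _ _ Ux Uy) (dr k).
  by rewrite ler_norml; rewrite /L in xL yL; lra.
have geom K : \sum_(k < K) e / 2 ^+ k.+1 = e - e / 2 ^+ K.
  elim: K => [|K IH]; first by rewrite big_ord0 expr0 divr1 subrr.
  by rewrite big_ord_recr/= IH exprS; field; rewrite expf_neq0.
have lightV : light V r s' 0 L.
  move=> K; apply: (@le_trans _ _ (\sum_(k < K) r k `^ s')).
    by rewrite big_mkcond; apply: ler_sum => k _; case: ifP => // _; exact: powR_ge0.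
  under eq_bigr do rewrite rs.
  rewrite big_split/= geom.
  have : 0 < e / 2 ^+ K by rewrite divr_gt0// exprn_gt0.
  have := sumd K; rewrite /e; lra.
have s'01 : 0 < s' < 1 by rewrite s'0 (lt_trans s'mu).
pose G n := hit_beyond mu omega (n./2 %% m) m (odd n) n.
have uG n : ubiquitous s' (G n).
  by apply: ubiquitous_hit_beyond => //; rewrite ltn_mod.
have [x x01 [Gx Vx]] := ubiquitous_avoid s'01 uG L0 rk Vr lightV.
have [k _ Uk] := AU _ (hit_beyond_approx_set m0 Gx).
by apply: (Vx k); split => //; rewrite add0r in x01.
Qed.

End Circle.

Theorem theorem3p2 (R : realType) (omega : R) (homega : irrational omega)
    (mu : R) (hmu : 1 < mu) (m : nat) (hm : (1 <= m)%N) :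
  hausdorff_dim (\bigcap_(l in `I_m) approx_set mu omega l m) = (mu^-1)%:E.
Proof.
have mu0 : 0 < mu by lra.
apply/eqP; rewrite eq_le; apply/andP; split.
  apply/lee_addgt0Pr => e e0; rewrite -EFinD; apply: ereal_inf_lbound.
  exists (mu^-1 + e) => //; split; first by rewrite addr_ge0// ?invr_ge0 ltW.
  by apply: hausdorff_measure_approx_set0 => //; rewrite ltrDl.
apply: le_ereal_inf_tmp => _ [s [s0 As0] <-]; rewrite lee_fin leNgt; apply/negP => smu.
by have := hausdorff_measure_approx_set_neq0 homega hm hmu s0 smu; rewrite As0 eqxx.
Qed.
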